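(* Let $\mathbf{k}$ be a field, $R=\mathbf{k}[\![x_1,\dots,x_n]\!]$ with maximal ideal $\mathfrak m$, let $A=R/I$ be a non-Gorenstein local Artin ring of socle degree $s\ge1$, and let $F_1,\dots,F_h\in\int_{\mathfrak m}I^\perp$ be polynomials whose classes form a $\mathbf{k}$-basis of $\mathcal{L}_{A,1}=\int_{\mathfrak m}I^\perp/I^\perp$. Then $\mathrm{gcl}(A)=1$ if and only if there exists a polynomial $F=\sum_{j=1}^ha_jF_j\in\int_{\mathfrak m}I^\perp$, $a_j\in\mathbf{k}$, such that $\dim_{\mathbf{k}}(\mathfrak m\circ F)=\dim_{\mathbf{k}}I^\perp$.
   Context: $S=\mathbf{k}[y_1,\dots,y_n]$ is an $R$-module by contraction: $x^\alpha\circ y^\beta=y^{\beta-\alpha}$ if $\beta\ge\alpha$ componentwise and $0$ otherwise. $I^\perp=\{G\in S: I\circ G=0\}$, $\langle F\rangle=R\circ F$, $\mathrm{Ann}_R F=\{f\in R: f\circ F=0\}$, $\mathfrak m\circ F=\{f\circ F: f\in\mathfrak m\}$, and $\int_K M=\{G\in S: K\circ G\subset M\}$ for an ideal $K$ of $R$ and an $R$-submodule $M\subset S$. $\ell$ denotes length. $G=R/\mathrm{Ann}_RF$ is a Gorenstein cover of $A=R/I$ if $I^\perp\subset\langle F\rangle$; the Gorenstein colength is $\mathrm{gcl}(A)=\min\{\ell(G)-\ell(A)\}$ over all Gorenstein covers $G$ of $A$. The socle degree of $A$ is the largest $i$ with $\mathfrak m^i\not\subset I$. *)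

(* Defs.v *)
From HB Require Import structures.
From mathcomp Require Import all_boot all_order all_algebra.
From mathcomp.multinomials Require Import mpoly.
From mathcomp Require Import boolp classical_sets functions.

Set Implicit Arguments.
Unset Strict Implicit.
Unset Printing Implicit Defensive.

Import GRing.Theory.

Local Open Scope classical_set_scope.
Local Open Scope ring_scope.

(* The formal power series ring k[[x_1, ..., x_n]]: a series is its family of
   coefficients, [f a] being the coefficient of x^a. *)
Definition pseries (n : nat) (k : fieldType) : Type := 'X_{1..n} -> k.

HB.instance Definition _ (n : nat) (k : fieldType) :=
  GRing.Lmodule.copy (pseries n k) ('X_{1..n} -> k^o).

Section PseriesRing.
Variables (n : nat) (k : fieldType).
Implicit Types (f g h : pseries n k) (m : 'X_{1..n}).

(* The bound on the degrees only makes the index type finite. *)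
Definition pseries_mul f g : pseries n k := fun m =>
  \sum_(c : 'X_{1..n < (mdeg m).+1, (mdeg m).+1} | m == (c.1 + c.2)%MM)
    f c.1 * g c.2.

Definition pseries_one : pseries n k := fun m => (m == 0%MM)%:R.

Definition pseries_trunc d f : {mpoly k[n]} :=
  \sum_(m : 'X_{1..n < d}) f m *: 'X_[m].

Lemma pseries_truncE d f m : (mdeg m < d)%N -> (pseries_trunc d f)@_m = f m.
Proof. exact: mcoeff_mpoly. Qed.

Lemma pseries_mulE d f g m : (mdeg m < d)%N ->
  pseries_mul f g m = (pseries_trunc d f * pseries_trunc d g)@_m.
Proof.
move=> lt_md; rewrite mcoeffM /pseries_mul; apply: eq_bigr => -[c1 c2] /= _.
by rewrite !pseries_truncE //; apply: (leq_trans _ lt_md); apply: bmdeg.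
Qed.

Lemma eq_mcoeffM d (p p' q q' : {mpoly k[n]}) m : (mdeg m < d)%N ->
  (forall m', (mdeg m' < d)%N -> p@_m' = p'@_m') ->
  (forall m', (mdeg m' < d)%N -> q@_m' = q'@_m') ->
  (p * q)@_m = (p' * q')@_m.
Proof.
move=> lt_md ep eq; rewrite !mcoeffM; apply: eq_bigr => -[c1 c2] /= _.
have lt_cd (c : 'X_{1..n < (mdeg m).+1}) : (mdeg c < d)%N.
  exact: leq_trans (bmdeg c) lt_md.
by rewrite ep // eq.
Qed.

Lemma pseries_mulA : associative pseries_mul.
Proof.
move=> f g h; apply/funext => m; have lt_m := ltnSn (mdeg m).
rewrite !(pseries_mulE _ _ lt_m).
rewrite (@eq_mcoeffM (mdeg m).+1 _ (pseries_trunc (mdeg m).+1 f) _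
  (pseries_trunc (mdeg m).+1 g * pseries_trunc (mdeg m).+1 h)) //; last first.
  by move=> m' lt_m'; rewrite pseries_truncE // (pseries_mulE _ _ lt_m').
rewrite mulrA; apply: (@eq_mcoeffM (mdeg m).+1) => // m' lt_m'.
by rewrite pseries_truncE // (pseries_mulE _ _ lt_m').
Qed.

Lemma pseries_mulC : commutative pseries_mul.
Proof.
move=> f g; apply/funext => m; have lt_m := ltnSn (mdeg m).
by rewrite !(pseries_mulE _ _ lt_m) mulrC.
Qed.

Lemma pseries_mul1 : left_id pseries_one pseries_mul.
Proof.
move=> f; apply/funext => m; have lt_m := ltnSn (mdeg m).
rewrite (pseries_mulE _ _ lt_m).
rewrite (@eq_mcoeffM (mdeg m).+1 _ 1 _ (pseries_trunc (mdeg m).+1 f)) //.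
  by rewrite mul1r pseries_truncE.
by move=> m' lt_m'; rewrite pseries_truncE // mcoeff1.
Qed.

Lemma pseries_mulDl : left_distributive pseries_mul +%R.
Proof.
move=> f g h; apply/funext => m; transitivity (pseries_mul f h m + pseries_mul g h m) => //.
by rewrite -big_split; apply: eq_bigr => c _ /=; rewrite -mulrDl.
Qed.

Lemma pseries_one_neq0 : pseries_one != 0 :> pseries n k.
Proof.
apply/eqP => /(congr1 (fun f : pseries n k => f 0%MM)) /eqP.
by rewrite /pseries_one eqxx oner_eq0.
Qed.

HB.instance Definition _ := GRing.Zmodule_isComNzRing.Build (pseries n k)
  pseries_mulA pseries_mulC pseries_mul1 pseries_mulDl pseries_one_neq0.

End PseriesRing.

Definition is_max (P : set nat) (d : nat) : Prop :=
  P d /\ forall e, P e -> (e <= d)%N.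

Definition is_min (P : set nat) (d : nat) : Prop :=
  P d /\ forall e, P e -> (d <= e)%N.

Section VectorSpaces.
Variables (k : fieldType) (V : lmodType k).
Implicit Types (U W : set V).

(* The elements F_1, ..., F_d of U have classes forming a basis of U/W. *)
Definition quot_basis U W (d : nat) (F : 'I_d -> V) : Prop :=
  [/\ forall j, U (F j),
      forall G, U G -> exists a : 'I_d -> k, W (G - \sum_j a j *: F j) &
      forall a : 'I_d -> k, W (\sum_j a j *: F j) -> forall j, a j = 0].

(* dim_k (U/W); the value is 0 when this dimension is infinite. *)
Definition quot_dim U W : nat :=
  xget 0%N [set d | exists F : 'I_d -> V, quot_basis U W F].

Definition subspace_dim U : nat := quot_dim U [set 0].

End VectorSpaces.

(* Quotients A/I are handled through the correspondence theorem: the ideals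
   (equivalently, the A-submodules) of A/I are the J/I with J an ideal of A
   containing I. *)
Section Ideals.
Variable A : comNzRingType.
Implicit Types (I J X : set A).

Definition is_ideal J : Prop :=
  [/\ J 0, forall f g, J f -> J g -> J (f + g) & forall f g, J g -> J (f * g)].

Definition ideal_mul I J : set A :=
  smallest is_ideal [set h | exists f g, [/\ I f, J g & h = f * g]].

Definition ideal_exp J (i : nat) : set A := iter i (ideal_mul J) setT.

Definition colon I J : set A := [set f | forall g, J g -> I (f * g)].

Definition maximal_ideal J : Prop :=
  [/\ is_ideal J, J != setT &
      forall J', is_ideal J' -> J `<=` J' -> J' = J \/ J' = setT].

Definition local_quot I : Prop :=
  exists! J : set A, maximal_ideal J /\ I `<=` J.

Definition artinian_quot I : Prop :=
  forall J : nat -> set A,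
    (forall i, is_ideal (J i) /\ I `<=` J i) ->
    (forall i, J i.+1 `<=` J i) ->
    exists N, forall i, (N <= i)%N -> J i = J N.

Definition ideal_chain I (l : nat) (J : nat -> set A) : Prop :=
  [/\ J 0%N = I, J l = setT,
      forall i, (i <= l)%N -> is_ideal (J i) &
      forall i, (i < l)%N -> J i `<` J i.+1].

(* The length of A/I; the value is 0 when this length is infinite. *)
Definition quot_length I : nat :=
  xget 0%N (is_max [set l | exists J : nat -> set A, ideal_chain I l J]).

End Ideals.

Section InverseSystems.
Variables (n : nat) (k : fieldType).
Local Notation R := (pseries n k).
Local Notation S := {mpoly k[n]}.
Implicit Types (I J K : set R) (M : set S) (f : R) (F G : S).

Definition maxid : set R := [set f | f 0%MM = 0].

Definition contract_mon (a b : 'X_{1..n}) : S :=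
  if (a <= b)%MM then 'X_[b - a] else 0.

(* Exponents a with mdeg a > mdeg b satisfy [contract_mon a b = 0]. *)
Definition contract f G : S :=
  \sum_(b <- msupp G) \sum_(a : 'X_{1..n < (mdeg b).+1})
    (f a * G@_b) *: contract_mon a b.

Definition perp I : set S := [set G | forall f, I f -> contract f G = 0].

Definition contract_set J F : set S := [set contract f F | f in J].

Definition cyclic_submod F : set S := contract_set setT F.

Definition ann F : set R := [set f | contract f F = 0].

Definition integral K M : set S :=
  [set G | forall f, K f -> M (contract f G)].

(* A = R/I, for R = k[[x_1, ..., x_n]], in the definitions below. *)

Definition socle_degree I (s : nat) : Prop :=
  is_max [set i | ~ (ideal_exp maxid i `<=` I)] s.

(* An Artinian local ring is Gorenstein when its socle, here (I : m)/I, is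
   one-dimensional over the residue field. *)
Definition gorenstein_quot I : Prop := quot_dim (colon I maxid) I = 1%N.

(* The cover is the quotient R/Ann(F) of R. *)
Definition gorenstein_cover I F : Prop := perp I `<=` cyclic_submod F.

(* The value is 0 when A has no Gorenstein cover R/Ann(F). *)
Definition gcl I : nat :=
  xget 0%N (is_min
    [set d | exists F, gorenstein_cover I F /\
       quot_length (ann F) = (quot_length I + d)%N]).

End InverseSystems.

Arguments maxid {n k}.

(* Main.v *)
(* Counting dual bases gives dim (perp I) = dim R/I = l(R/I) as soon as I contains
   a power of the maximal ideal m, and R/Ann F is isomorphic to <F>, in which m o F
   has codimension 1 when F <> 0.  A cover F of colength 1 thus satisfies
   perp I = m o F: in the simple module <F>/(perp I) everything is killed by m, and
   dimensions agree.  Nakayama's lemma lets one subtract from F its component in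
   perp I, which leaves a combination of the F_j.  Conversely, perp I = m o F makes
   F a cover of colength 1, and colength 0 would give I = Ann F, which is
   Gorenstein. *)
From HB Require Import structures.
Require Import Defs.
From mathcomp Require Import all_boot all_order all_algebra.
From mathcomp.multinomials Require Import mpoly.
From mathcomp Require Import boolp classical_sets functions.

Set Implicit Arguments.
Unset Strict Implicit.
Unset Printing Implicit Defensive.

Import GRing.Theory.

Local Open Scope classical_set_scope.
Local Open Scope ring_scope.

(** * Dimensions of quotients of subspaces, without forming the quotients *)

Section QuotientDimension.
Variables (k : fieldType) (V : lmodType k).
Implicit Types (U W X : set V).

Definition is_subspace W : Prop :=
  [/\ W 0, forall u v, W u -> W v -> W (u + v) & forall c v, W v -> W (c *: v)].

Lemma subspaceN W u : is_subspace W -> W u -> W (- u).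
Proof. by case=> _ _ WZ Wu; rewrite -scaleN1r; apply: WZ. Qed.

Lemma subspaceB W u v : is_subspace W -> W u -> W v -> W (u - v).
Proof. by move=> sW Wu Wv; case: (sW) => _ WD _; apply: WD (subspaceN sW Wv). Qed.

Lemma subspace_sum W (T : finType) (F : T -> V) (a : T -> k) :
  is_subspace W -> (forall i, W (F i)) -> W (\sum_i a i *: F i).
Proof.
by case=> W0 WD WZ WF; apply: (big_ind W) => // i _; apply: WZ.
Qed.

Lemma subspace0 : is_subspace [set 0 : V].
Proof. by split=> // [u v -> ->|c v ->]; rewrite /= ?addr0 ?scaler0. Qed.

(** Relational form of [quot_dim]: it retains the existence of a finite basis, which the default
    value 0 of [quot_dim] hides. *)
Definition qdim U W d := exists F : 'I_d -> V, quot_basis U W F.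

Definition indep_mod W d (F : 'I_d -> V) :=
  forall a : 'I_d -> k, W (\sum_j a j *: F j) -> forall j, a j = 0.

(** A vector in the left kernel of the matrix of coordinates of the [F'] along the [F] is a relation
    between the [F'] modulo [W], hence zero. The rows are thus free and no more numerous than the
    columns. *)
Lemma indep_mod_le_span W d d' (F : 'I_d -> V) (F' : 'I_d' -> V) :
    is_subspace W ->
    (forall i, exists a : 'I_d -> k, W (F' i - \sum_j a j *: F j)) ->
  indep_mod W F' -> (d' <= d)%N.
Proof.
move=> sW /choice [A WA] indF'.
pose M := \matrix_(i < d', j < d) A i j.
suff : row_free M by move/eqP <-; apply: rank_leq_col.
apply: inj_row_free => v vM0; apply/rowP => i; rewrite mxE.
apply: (indF' (fun i => v 0 i)).
suff -> : \sum_j v 0 j *: F' j =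
    \sum_j v 0 j *: (F' j - \sum_l A j l *: F l) by apply: subspace_sum.
under [RHS]eq_bigr do rewrite scalerBr.
rewrite sumrB (_ : \sum_(i0 < d') v 0 i0 *: \sum_l _ = 0) ?subr0 //.
under eq_bigr do rewrite scaler_sumr.
rewrite exchange_big big1 //= => l _.
under eq_bigr do rewrite scalerA.
rewrite -scaler_suml; move/rowP/(_ l): vM0; rewrite !mxE => vM0.
rewrite (_ : \sum_i _ = 0) ?scale0r // -[RHS]vM0.
by apply: eq_bigr => j _; rewrite mxE.
Qed.

Lemma qdim_uniq U W d d' : is_subspace W -> qdim U W d -> qdim U W d' -> d = d'.
Proof.
move=> sW [F [UF FU Fi]] [F' [UF' FU' Fi']]; apply/eqP; rewrite eqn_leq.
apply/andP; split.
  exact: (indep_mod_le_span sW (fun i => FU' _ (UF i)) Fi).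
exact: (indep_mod_le_span sW (fun i => FU _ (UF' i)) Fi').
Qed.

Lemma quot_dimE U W d : is_subspace W -> qdim U W d -> quot_dim U W = d.
Proof.
by move=> sW Ud; apply: xget_unique => // e Ue; apply: qdim_uniq Ue Ud.
Qed.

(** A family in [U] independent modulo [W] is also independent modulo [W0], so it has at most [d]
    members. One of maximal size spans, since any vector outside its span modulo [W] would extend
    it. *)
Lemma qdim_sub U0 W0 U W d : is_subspace W0 -> is_subspace W ->
    W0 `<=` W -> U `<=` U0 -> qdim U0 W0 d ->
  exists2 d', qdim U W d' & (d' <= d)%N.
Proof.
move=> sW0 sW W0W UU0 [F [_ FU _]].
pose P m := `[< exists F' : 'I_m -> V, (forall i, U (F' i)) /\ indep_mod W F' >].
have Pd m : P m -> (m <= d)%N.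
  move=> /asboolP[F' [UF' iF']].
  apply: (indep_mod_le_span sW0 (fun i => FU _ (UU0 _ (UF' i)))).
  by move=> a /W0W; apply: iF'.
have P0 : exists m, P m.
  by exists 0%N; apply/asboolP; exists (fun _ => 0); split=> [[]|a _ []].
case: (ex_maxnP P0 Pd) => m /[dup] /Pd md /asboolP[F' [UF' iF']] mmax.
exists m => //; exists F'; split=> // G UG; apply: contrapT => nG.
suff /mmax : P m.+1 by rewrite ltnn.
pose F1 (i : 'I_m.+1) := if unlift ord0 i is Some j then F' j else G.
apply/asboolP; exists F1; split=> [i|a].
  by rewrite /F1; case: unliftP => [j|] _.
have [W_0 WD WZ] := sW.
rewrite big_ord_recl {1}/F1 unlift_none.
under eq_bigr do rewrite /F1 liftK.
have [a0|a0] := eqVneq (a ord0) 0.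
  rewrite a0 scale0r add0r => /iF' a_0 j.
  by case: (unliftP ord0 j) => [i|] ->.
move=> /(WZ (a ord0)^-1); rewrite scalerDr scalerA mulVf // scale1r => WG.
case: nG; exists (fun i => - ((a ord0)^-1 * a (lift ord0 i))).
rewrite -sumrN; under eq_bigr do rewrite scaleNr opprK -scalerA.
by rewrite -scaler_sumr.
Qed.

Lemma qdim_add U W X d e : is_subspace W -> is_subspace X ->
    X `<=` W -> W `<=` U -> qdim U W d -> qdim W X e -> qdim U X (d + e).
Proof.
move=> sW sX XW WU [F [UF FU iF]] [G [WG GW iG]].
pose H (i : 'I_(d + e)) := match fintype.split i with inl j => F j | inr j => G j end.
have sumH a : \sum_i a i *: H i =
    \sum_i a (lshift e i) *: F i + \sum_i a (rshift d i) *: G i.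
  rewrite big_split_ord /=; congr (_ + _); apply: eq_bigr => i _.
    by rewrite /H (unsplitK (inl i)).
  by rewrite /H (unsplitK (inr i)).
exists H; split=> [i|u Uu|a].
- by rewrite /H; case: fintype.split => j; [apply: UF|apply/WU/WG].
- have [a /GW [b Xb]] := FU u Uu.
  exists (fun i => match fintype.split i with inl j => a j | inr j => b j end).
  rewrite sumH opprD addrA.
  under eq_bigr do rewrite (unsplitK (inl _)).
  by under [X in _ - X]eq_bigr do rewrite (unsplitK (inr _)).
- rewrite sumH => Xa.
  have aF i : a (lshift e i) = 0.
    apply: (iF (fun i => a (lshift e i))).
    rewrite -[X in W X](addrK (\sum_i a (rshift d i) *: G i)).
    by apply: subspaceB => //; [apply: XW|apply: subspace_sum].
  move: Xa; under eq_bigr do rewrite aF scale0r.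
  rewrite big1 // add0r => /iG aG i.
  by case: (split_ordP i) => j ->; rewrite ?aF ?aG.
Qed.

Lemma qdim0_sub U W : is_subspace W -> qdim U W 0 -> U `<=` W.
Proof.
by move=> sW [F [_ FU _]] u /FU[a]; rewrite big_ord0 subr0.
Qed.

Lemma qdim_self W : is_subspace W -> qdim W W 0.
Proof.
move=> [W0 WD WZ]; exists (fun _ => 0); split=> [[]//|u Wu|a _ [] //].
by exists (fun _ => 0); rewrite big_ord0 subr0.
Qed.

(** By additivity the dimension of U/W is 0. *)
Lemma qdim_eq U W X d : is_subspace U -> is_subspace W -> is_subspace X ->
    X `<=` W -> W `<=` U -> qdim U X d -> qdim W X d -> U = W.
Proof.
move=> sU sW sX XW WU UX WX; rewrite eqEsubset; split=> //.
have [e UW _] := qdim_sub sX sW XW (@subset_refl _ U) UX.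
apply: qdim0_sub => //.
have /(qdim_uniq sX UX) /eqP := qdim_add sW sX XW WU UW WX.
by rewrite -[X in X == _]add0n eqn_add2r => /eqP ->.
Qed.

Lemma qdim1 U W u : is_subspace W -> U u -> ~ W u ->
    (forall v, U v -> exists c, W (v - c *: u)) -> qdim U W 1.
Proof.
move=> sW Uu nWu Usp; exists (fun _ => u); split=> // [v /Usp[c Wc]|a].
  by exists (fun _ => c); rewrite big_ord1.
rewrite big_ord1 => Wa j; rewrite ord1; apply/eqP/negPn/negP => a0; apply: nWu.
case: sW => _ _ /(_ (a ord0)^-1 _ Wa).
by rewrite scalerA mulVf // scale1r.
Qed.

Lemma qdim1_span U W u v : is_subspace W -> qdim U W 1 -> U u -> ~ W u -> U v ->
  exists c, W (v - c *: u).
Proof.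
move=> sW [w [_ wsp _]] /wsp[a] + nWu /wsp[b]; rewrite !big_ord1.
case: (sW) => W0 WD WZ Wa Wb.
have a0 : a ord0 != 0.
  by apply/eqP => a0; apply: nWu; rewrite a0 scale0r subr0 in Wa.
exists (b ord0 / a ord0).
rewrite -(subrKA (b ord0 *: w ord0)); apply: WD => //.
rewrite -opprB; apply: subspaceN => //.
by have := WZ (b ord0 / a ord0) _ Wa; rewrite scalerBr scalerA divfK.
Qed.

End QuotientDimension.

(** * Power series by coefficients, and the powers of the maximal ideal *)

Section PowerSeries.
Variables (n : nat) (k : fieldType).
Local Notation R := (pseries n k).
Implicit Types (f g : R) (a b c m : 'X_{1..n}) (D : nat).

Lemma big_bmnm_pred1 D c (phi : 'X_{1..n} -> k) : (mdeg c < D)%N ->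
  \sum_(a : 'X_{1..n < D}) phi a * ((a : 'X_{1..n}) == c)%:R = phi c.
Proof.
move=> cD; rewrite (bigD1 (BMultinom cD)) //= eqxx mulr1 big1 ?addr0 // => a.
by rewrite bmeqP /= => /negPf ->; rewrite mulr0.
Qed.

Lemma big_bmnm_shift D m c (phi : 'X_{1..n} -> k) : (mdeg m < D)%N ->
  \sum_(a : 'X_{1..n < D}) phi a * (m == (a + c)%MM)%:R =
    if (c <= m)%MM then phi (m - c)%MM else 0.
Proof.
move=> mD; case: ifPn => [cm|ncm].
  rewrite -(big_bmnm_pred1 phi (leq_ltn_trans (mdegB m c) mD)).
  by apply: eq_bigr => a _; rewrite -{1}(submK cm) eqm_add2r eq_sym.
rewrite big1 // => a _; case: eqP => [E|_]; last by rewrite mulr0.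
by rewrite E lem_addl in ncm.
Qed.

Lemma seriesDE f g m : (f + g) m = f m + g m. Proof. by []. Qed.
Lemma seriesNE f m : (- f) m = - f m. Proof. by []. Qed.
Lemma seriesZE (x : k) f m : (x *: f) m = x * f m. Proof. by []. Qed.

(** The bound [D] may exceed the degree of [m], so coefficients at different [m] can share index
    types and their sums can be exchanged. *)
Lemma seriesM_wide D f g m : (mdeg m < D)%N ->
  (f * g) m = \sum_(u : 'X_{1..n < D}) \sum_(v : 'X_{1..n < D})
    f u * g v * (m == (u + v)%MM)%:R.
Proof.
move=> mD; rewrite [LHS](pseries_mulE f g mD) [LHS](mcoeff_poly_mul _ _ mD).
rewrite pair_big big_mkcond; apply: eq_bigr => -[u v] _ /=.
by rewrite !pseries_truncE ?bmdeg //; case: eqP; rewrite (mulr1, mulr0).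
Qed.

Lemma seriesZAl (x : k) f g : x *: (f * g) = (x *: f) * g.
Proof.
apply/funext => m; rewrite seriesZE !(seriesM_wide _ _ (ltnSn _)) mulr_sumr.
by apply: eq_bigr => u _; rewrite mulr_sumr; apply: eq_bigr => v _; rewrite !mulrA.
Qed.

Lemma seriesZAr (x : k) f g : x *: (f * g) = f * (x *: g).
Proof. by rewrite mulrC seriesZAl mulrC. Qed.

Lemma series1_0 : (1 : R) 0%MM = 1.
Proof. by rewrite /GRing.one /= /pseries_one eqxx. Qed.

Lemma ideal_subspace (I : set R) : is_ideal I -> is_subspace I.
Proof.
by case=> I0 ID IM; split=> // x f If; rewrite -[f]mul1r seriesZAl; apply: IM.
Qed.

Definition smonom c : R := fun m => (m == c)%:R.

Lemma smonomM c f m :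
  (smonom c * f) m = if (c <= m)%MM then f (m - c)%MM else 0.
Proof.
rewrite mulrC; pose D := (mdeg m + mdeg c).+1.
have mD : (mdeg m < D)%N by rewrite ltnS leq_addr.
have cD : (mdeg c < D)%N by rewrite ltnS leq_addl.
rewrite (seriesM_wide _ _ mD) -(big_bmnm_shift _ f mD); apply: eq_bigr => u _.
rewrite -(big_bmnm_pred1 (fun v => f u * (m == (u + v)%MM)%:R) cD).
by apply: eq_bigr => v _; rewrite mulrAC.
Qed.

(** A coefficientwise description of the [D]-th power of the maximal ideal, tied to [ideal_exp] by
    [vanish_sub_ideal_exp]. *)
Definition vanish D : set R := [set f | forall m, (mdeg m < D)%N -> f m = 0].

Lemma vanishM D E f g : vanish D f -> vanish E g -> vanish (D + E) (f * g).
Proof.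
move=> fD gE m mDE; rewrite (seriesM_wide _ _ (ltnSn _)).
rewrite big1 // => u _; rewrite big1 // => v _.
case: eqP => [E0|_]; last by rewrite mulr0.
case: (ltnP (mdeg u) D) => [/fD ->|uD]; first by rewrite !mul0r.
rewrite gE ?mulr0 ?mul0r //.
rewrite ltnNge; apply/negP => vE.
by move: mDE; rewrite E0 mdegD ltnNge leq_add.
Qed.

Lemma maxid_vanish : maxid = vanish 1.
Proof.
rewrite eqEsubset; split=> f /=.
  by move=> f0 m; rewrite ltnS leqn0 mdeg_eq0 => /eqP ->.
by apply; rewrite mdeg0.
Qed.

Lemma vanish_ideal D : is_ideal (vanish D).
Proof.
split=> [m //|f g fD gD m mD|f g gD].
  by rewrite seriesDE fD ?gD ?addr0.
by rewrite -[D]add0n; apply: vanishM => // m.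
Qed.

Lemma vanish_subspace D : is_subspace (vanish D).
Proof. exact/ideal_subspace/vanish_ideal. Qed.

Lemma maxidXn f N : maxid f -> vanish N (f ^+ N).
Proof.
rewrite maxid_vanish => f1; elim: N => [m //|N IH].
by rewrite exprS; apply: (@vanishM 1).
Qed.

(* A series without constant term splits along the first variable occurring in
   each monomial, and the part attached to [i] is divisible by [x_i]. *)
Lemma vanish_sub_ideal_exp D : vanish D `<=` ideal_exp maxid D.
Proof.
elim: D => [//|D IH] f fD J [Jideal Jgen].
pose first (i : 'I_n) m := (0 < m i)%N && [forall j : 'I_n, (j < i)%N ==> (m j == 0%N)].
pose g i : R := fun m => (first i (m + U_(i))%MM)%:R * f (m + U_(i))%MM.
have gD i : vanish D (g i).
  by move=> m mD; rewrite /g fD ?mulr0 // mdegD mdeg1 addn1.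
have Ug m i : (smonom U_(i)%MM * g i) m = (first i m)%:R * f m.
  rewrite smonomM; case: ifPn => [im|]; first by rewrite /g submK.
  case m0 : (0 < m i)%N; last by rewrite /first m0 mul0r.
  case/negP; apply/mnm_lepP => j; rewrite mnm1E.
  by case: eqP => [<-|//].
have -> : f = \sum_(i < n) smonom U_(i)%MM * g i.
  apply/funext => m.
  have sumE (r : seq 'I_n) (G : 'I_n -> R) :
      (\sum_(i <- r) G i) m = \sum_(i <- r) G i m.
    by elim: r => [|x r IHr]; rewrite ?big_nil // !big_cons -IHr.
  rewrite sumE; under eq_bigr do rewrite Ug.
  have [m0|m0] := eqVneq m 0%MM.
    by rewrite m0 fD ?mdeg0 //; under eq_bigr do rewrite mulr0; rewrite big1.
  have [i0 mi0] : exists i, (0 < m i)%N.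
    apply/existsP; rewrite -[[exists _, _]]negbK negb_exists; apply: contra m0.
    move=> /forallP m0; apply/eqP/mnmP => i; rewrite mnm0E; apply/eqP.
    by rewrite -leqn0 leqNgt.
  case: (@arg_minnP _ i0 (fun i => 0 < m i)%N val mi0) => i mi imin.
  rewrite (bigD1 i) //= big1 ?addr0 => [|j ji].
    rewrite (_ : first i m) ?mul1r //; apply/andP; split=> //.
    apply/forallP => j; apply/implyP => ji; rewrite -leqn0 leqNgt.
    by apply/negP => /imin; rewrite leqNgt ji.
  rewrite (_ : first j m = false) ?mul0r //; apply/negP => /andP[mj /forallP mmin].
  have /implyP := mmin i; have := imin j mj; rewrite leq_eqVlt => /predU1P[E|-> /(_ isT)].
    by case/eqP: ji; apply: val_inj.
  by move=> /eqP m_i; rewrite m_i in mi.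
have [J0 JD JM] := Jideal.
apply: (big_ind J) => // i _; apply: Jgen; exists (smonom U_(i)%MM), (g i); split=> //.
  by rewrite /maxid /smonom /= eq_sym mnm1_eq0.
exact: IH.
Qed.

(** The monomials of degree below [D] form a basis. Finite dimension of the other quotients of R
    follows through [qdim_sub]. *)
Lemma qdim_setT_vanish D : exists d, qdim [set: R] (vanish D) d.
Proof.
pose e (i : 'I_#|{: 'X_{1..n < D}}|) : 'X_{1..n < D} := enum_val i.
exists #|{: 'X_{1..n < D}}|, (fun i => smonom (e i)).
have sumE (a : 'I_#|{: 'X_{1..n < D}}| -> k) (c : 'X_{1..n < D}) :
    (\sum_j a j *: smonom (e j)) c = a (enum_rank c).
  transitivity (\sum_j (a j *: smonom (e j)) c).
    by elim/big_rec2: _ => // i x y _ <-.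
  rewrite (bigD1 (enum_rank c)) //= big1 => [|j jc].
    by rewrite /e enum_rankK seriesZE /smonom eqxx mulr1 addr0.
  rewrite seriesZE /smonom; case: eqP => [/val_inj E|]; last by rewrite mulr0.
  by rewrite E /e enum_valK eqxx in jc.
split=> // [f _|a aD j].
  exists (fun i => f (e i)) => m mD.
  have -> : m = BMultinom mD by [].
  by rewrite seriesDE seriesNE sumE /e enum_rankK subrr.
by rewrite -(enum_valK j) -sumE aD ?bmdeg.
Qed.

End PowerSeries.

(** * The contraction action and the cyclic modules it generates *)

Section Contraction.
Variables (n : nat) (k : fieldType).
Local Notation R := (pseries n k).
Local Notation S := {mpoly k[n]}.
Implicit Types (f g : R) (F G H : S) (a b c m : 'X_{1..n}) (D : nat).

Lemma mcoeff_ge_msize G D m : (msize G <= D)%N -> (D <= mdeg m)%N -> G@_m = 0.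
Proof.
by move=> GD Dm; apply/memN_msupp_eq0/msize_mdeg_ge/(leq_trans GD).
Qed.

(** The substitution b = a + c turns the sum over the support of [G] into a sum over exponents [a].
    With a free bound [D], several polynomials can share one index type. *)
Lemma contractE D f G c : (msize G <= D)%N ->
  (contract f G)@_c = \sum_(a : 'X_{1..n < D}) f a * G@_(a + c).
Proof.
move=> GD.
transitivity (\sum_(b <- msupp G) (if (c <= b)%MM then f (b - c)%MM else 0) * G@_b).
  rewrite raddf_sum; apply: eq_bigr => b _; rewrite /= raddf_sum /=.
  rewrite -(big_bmnm_shift c f (ltnSn (mdeg b))) mulr_suml.
  apply: eq_bigr => a _; rewrite mcoeffZ /contract_mon mulrAC; congr (_ * _).
  case: ifPn => [ab|nab]; last first.
    rewrite mcoeff0; case: eqP => // E.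
    by have := lem_addr a c; rewrite -E (negPf nab).
  by rewrite mcoeffX -(eqm_add2r a) submK // addmC.
under [RHS]eq_bigr => a _.
  rewrite (_ : G@_(a + c) = \sum_(b <- msupp G) G@_b * (b == (a + c)%MM)%:R); last first.
    rewrite {1}[G]mpolyE raddf_sum /=; apply: eq_bigr => b _.
    by rewrite mcoeffZ mcoeffX.
  rewrite mulr_sumr.
over.
rewrite exchange_big; apply: eq_big_seq => b bG /=.
have bD : (mdeg b < D)%N by apply: leq_trans GD; apply: msize_mdeg_lt.
rewrite -(big_bmnm_shift c f bD) mulr_suml; apply: eq_bigr => a _.
by rewrite mulrA mulrAC.
Qed.

Lemma contract_linear_l G x f g :
  contract (x *: f + g) G = x *: contract f G + contract g G.
Proof.
apply/mpolyP => c; rewrite mcoeffD mcoeffZ !(contractE _ _ (leqnn _)).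
rewrite mulr_sumr -big_split; apply: eq_bigr => a _ /=.
by rewrite seriesDE seriesZE mulrDl mulrA.
Qed.

Lemma contract_linear_r f x G H :
  contract f (x *: G + H) = x *: contract f G + contract f H.
Proof.
apply/mpolyP => c; rewrite mcoeffD mcoeffZ.
pose D := maxn (msize (x *: G + H)) (maxn (msize G) (msize H)).
rewrite !(@contractE D) ?leq_max ?leqnn ?orbT //.
rewrite mulr_sumr -big_split; apply: eq_bigr => a _ /=.
by rewrite mcoeffD mcoeffZ mulrDr mulrCA.
Qed.

HB.instance Definition _ f := GRing.isLinear.Build k S S _ (contract f)
  (fun x G H => contract_linear_r f x G H).

(** Swapped arguments, so that linearity in the series can also be a canonical instance. *)
Definition contractr G f := contract f G.

HB.instance Definition _ G := GRing.isLinear.Build k R S _ (contractr G)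
  (fun x f g => contract_linear_l G x f g).

Lemma contractDl f g G : contract (f + g) G = contract f G + contract g G.
Proof. exact: (raddfD (contractr G)). Qed.

Lemma contractBl f g G : contract (f - g) G = contract f G - contract g G.
Proof. exact: (raddfB (contractr G)). Qed.

Lemma contract0l G : contract 0 G = 0.
Proof. exact: (raddf0 (contractr G)). Qed.

Lemma contractZl x f G : contract (x *: f) G = x *: contract f G.
Proof. exact: (linearZ_LR (contractr G)). Qed.

Lemma contractZr x f G : contract f (x *: G) = x *: contract f G.
Proof. exact: (linearZ_LR (contract f)). Qed.

Lemma contract_lincombl (T : finType) (a : T -> k) (F_ : T -> R) G :
  contract (\sum_i a i *: F_ i) G = \sum_i a i *: contract (F_ i) G.
Proof.
rewrite [LHS](raddf_sum (contractr G)); apply: eq_bigr => i _.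
exact: contractZl.
Qed.

Lemma contract_lincombr (T : finType) (a : T -> k) f (G_ : T -> S) :
  contract f (\sum_i a i *: G_ i) = \sum_i a i *: contract f (G_ i).
Proof. by rewrite raddf_sum; apply: eq_bigr => i _; apply: contractZr. Qed.

Lemma msize_contract f G : (msize (contract f G) <= msize G)%N.
Proof.
rewrite msizeE; apply/bigmax_leqP_seq => c; rewrite mcoeff_msupp => + _.
apply: contraNT; rewrite -leqNgt => Gc; rewrite (contractE _ _ (leqnn _)).
rewrite big1 // => a _; rewrite (@mcoeff_ge_msize G (msize G)) ?mulr0 //.
by apply: (leq_trans Gc); rewrite mdegD leq_addl.
Qed.

Lemma contractM f g G : contract (f * g) G = contract f (contract g G).
Proof.
apply/mpolyP => c; pose D := msize G.
rewrite (contractE _ _ (leqnn D)) (contractE _ _ (msize_contract g G)).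
under eq_bigr => a _.
  rewrite (seriesM_wide _ _ (bmdeg a)) mulr_suml.
  under eq_bigr => u _ do rewrite mulr_suml.
over.
rewrite exchange_big; apply: eq_bigr => u _ /=.
rewrite exchange_big (contractE _ _ (leqnn D)) mulr_sumr.
apply: eq_bigr => v _ /=; rewrite addmA [(v + u)%MM]addmC mulrA.
(* On the left, a = u + v only ranges over degrees below [D]. A pair with a larger sum is missing
   there, and its term on the right vanishes because of the size of [G]. *)
case: (ltnP (mdeg (u + v)%MM) D) => [uvD|Duv].
  rewrite -(big_bmnm_pred1 (fun m => f u * g v * G@_(m + c)) uvD).
  by apply: eq_bigr => a _; rewrite mulrAC.
rewrite (@mcoeff_ge_msize G D) // ?mulr0; last first.
  by rewrite mdegD (leq_trans Duv) ?leq_addr.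
rewrite big1 // => a _; case: eqP => [E|_]; last by rewrite mulr0 mul0r.
by rewrite -E leqNgt bmdeg in Duv.
Qed.

Lemma contract_smonom b G c : (contract (smonom k b) G)@_c = G@_(b + c).
Proof.
pose D := maxn (msize G) (mdeg b).+1.
rewrite (@contractE D) ?leq_maxl //.
rewrite -(@big_bmnm_pred1 _ _ D b (fun a => G@_(a + c))) ?leq_maxr //.
by apply: eq_bigr => a _; rewrite mulrC.
Qed.

Lemma contract1 G : contract 1 G = G.
Proof. by apply/mpolyP => c; rewrite [LHS]contract_smonom add0m. Qed.

Lemma contract_vanish f G : vanish (msize G) f -> contract f G = 0.
Proof.
move=> fG; apply/mpolyP => c; rewrite (contractE _ _ (leqnn _)) mcoeff0.
by rewrite big1 // => a _; rewrite fG ?mul0r ?bmdeg.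
Qed.

(** Reduces every coefficient to the pairing that sends (g, G) to the constant term of g o G. *)
Lemma mcoeff_contract f G c : (contract f G)@_c = (contract (smonom k c * f) G)@_0.
Proof. by rewrite contractM contract_smonom addm0. Qed.

Lemma ann_ideal G : is_ideal (@ann n k G).
Proof.
split=> [|f g fG gG|f g gG]; rewrite /ann /=.
- exact: contract0l.
- by rewrite contractDl fG gG addr0.
- by rewrite contractM gG raddf0.
Qed.

Lemma vanish_sub_ann G : vanish (msize G) `<=` @ann n k G.
Proof. by move=> f; apply: contract_vanish. Qed.

Lemma perp_subspace (I : set R) : is_subspace (perp I).
Proof.
split=> [f _|F G FI GI f If|c G GI f If].
- exact: raddf0.
- by rewrite raddfD /= FI ?GI ?addr0.
- by rewrite contractZr GI ?scaler0.
Qed.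

Lemma perp_contract (I : set R) f G : perp I G -> perp I (contract f G).
Proof. by move=> GI g Ig; rewrite -contractM mulrC contractM GI ?raddf0. Qed.

Lemma contract_set_subspace (J : set R) G : is_ideal J -> is_subspace (contract_set J G).
Proof.
move=> /ideal_subspace[J0 JD JZ]; split=> [|_ _ [f Jf <-] [g Jg <-]|c _ [f Jf <-]].
- by exists 0; rewrite ?contract0l.
- by exists (f + g); [apply: JD|rewrite contractDl].
- by exists (c *: f); [apply: JZ|rewrite contractZl].
Qed.

Lemma setT_ideal : is_ideal [set: R].
Proof. by []. Qed.

Lemma cyclic_subspace G : is_subspace (cyclic_submod G).
Proof. exact: contract_set_subspace setT_ideal. Qed.

(* [1 - f] acts invertibly: its inverse is the geometric series, which is finite
   modulo the annihilator of [G]. *)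
Lemma contract_1subr_inv f G : maxid f ->
  exists u, contract (u * (1 - f)) G = G.
Proof.
move=> mf; exists (\sum_(i < msize G) f ^+ i).
rewrite mulrC -opprB mulNr -subrX1 opprB contractBl contract1.
by rewrite contract_vanish ?subr0 //; apply: maxidXn.
Qed.

(** The isomorphism from R/Ann G to <G> given by f -> f o G carries a basis to a basis. *)
Lemma qdim_cyclic G d : qdim setT (ann G) d -> qdim (cyclic_submod G) [set 0] d.
Proof.
case=> f [_ fsp find]; exists (fun i => contract (f i) G); split.
- by move=> j; exists (f j).
- move=> _ [g _ <-]; have [a ag] := fsp g I; exists a.
  by rewrite /= -contract_lincombl -contractBl.
- by move=> a /=; rewrite -contract_lincombl; apply: find.
Qed.

(** The leading monomial has maximal degree, so contracting by it leaves only a constant. This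
    series will represent a socle generator of R/Ann G. *)
Lemma contract_lead G : G != 0 ->
  contract ((G@_(mlead G))^-1 *: smonom k (mlead G)) G = 1.
Proof.
move=> G0; apply/mpolyP => c; rewrite contractZl mcoeffZ contract_smonom mcoeff1.
have [->|c0] := eqVneq c 0%MM.
  by rewrite addm0 mulVf // mleadc_eq0.
rewrite (@mcoeff_ge_msize G (msize G) (mlead G + c)) ?mulr0 ?(negPf c0) // -mlead_deg // mdegD.
by rewrite -addn1 leq_add2l lt0n mdeg_eq0.
Qed.

Lemma maxid_contract_eq0 G : (forall f, maxid f -> contract f G = 0) ->
  G = G@_0 *: 1.
Proof.
move=> Gm; apply/mpolyP => c; rewrite mcoeffZ mcoeff1.
have [->|c0] := eqVneq c 0%MM; first by rewrite mulr1.
have := Gm (smonom k c); rewrite /maxid /= /smonom eq_sym (negPf c0) => /(_ erefl) E.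
by have := contract_smonom c G 0%MM; rewrite E mcoeff0 addm0 mulr0.
Qed.

(** The class of [G] is a basis: f o G differs from f(0) G by (f - f(0)) o G, and f o G = G with f
    in m would make the unit 1 - f kill [G]. *)
Lemma qdim_cyclic_maxid G : G != 0 ->
  qdim (cyclic_submod G) (contract_set maxid G) 1.
Proof.
move=> G0; apply: (@qdim1 _ _ _ _ G).
- rewrite maxid_vanish; exact/contract_set_subspace/vanish_ideal.
- by exists 1; rewrite ?contract1.
- case=> f mf fG; have [u] := contract_1subr_inv G mf.
  rewrite contractM contractBl contract1 fG subrr raddf0 => /esym/eqP.
  by rewrite (negPf G0).
- move=> _ [f _ <-]; exists (f 0%MM); exists (f - f 0%MM *: (1 : R)).
    rewrite /maxid /= seriesDE seriesNE seriesZE.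
    by rewrite series1_0 mulr1 subrr.
  by rewrite contractBl contractZl contract1.
Qed.

(** If m v kills [G], then v o G is killed by m and so is a constant; this constant is the
    coordinate of v along the socle element [u]. *)
Lemma gorenstein_quot_ann G : G != 0 -> gorenstein_quot (ann G).
Proof.
move=> G0; have sA : is_subspace (ann G) by apply/ideal_subspace/ann_ideal.
set u := (G@_(mlead G))^-1 *: smonom k (mlead G).
have uG : contract u G = 1 by apply: contract_lead.
apply: quot_dimE => //; apply: (@qdim1 _ _ _ _ u) => //.
- move=> g mg; rewrite /ann /= mulrC contractM uG.
  by apply: contract_vanish; rewrite msize1 -maxid_vanish.
- by rewrite /ann /= uG => /eqP; rewrite oner_eq0.
- move=> v vm; exists (contract v G)@_0.
  rewrite /ann /= contractBl contractZl uG; apply/eqP; rewrite subr_eq0; apply/eqP.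
  by apply: maxid_contract_eq0 => g mg; rewrite -contractM mulrC; apply: vm.
Qed.

End Contraction.

(** * Length as dimension, and duality between R/I and its inverse system *)

Section Length.
Variables (n : nat) (k : fieldType).
Local Notation R := (pseries n k).
Local Notation S := {mpoly k[n]}.
Implicit Types (I : set R) (D : nat).

Lemma qdim_quot I D : is_ideal I -> vanish D `<=` I -> exists d, qdim setT I d.
Proof.
move=> /ideal_subspace sI DI; have [e De] := @qdim_setT_vanish n k D.
by have [d] := qdim_sub (@vanish_subspace n k D) sI DI (@subset_refl _ setT) De; exists d.
Qed.

(** Each strict inclusion lowers the dimension of the quotient by at least 1. *)
Lemma ideal_chain_le_qdim D l I (J : nat -> set R) d : vanish D `<=` I ->
  ideal_chain I l J -> qdim setT I d -> (l <= d)%N.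
Proof.
elim: l I J d => [//|l IH] I J d DI [J0 Jl Jid Jlt] Id.
have sI : is_subspace I by rewrite -J0; apply/ideal_subspace/Jid.
have iJ1 := Jid 1%N isT; have sJ1 := ideal_subspace iJ1.
have [IJ1 nJ1I] : I `<` J 1%N by rewrite -J0; apply: Jlt.
have DJ1 : vanish D `<=` J 1%N := subset_trans DI IJ1.
have [d1 d1P] := qdim_quot iJ1 DJ1.
have [e eP _] := qdim_sub sI sI (@subset_refl _ I) (@subsetT _ (J 1%N)) Id.
have := qdim_uniq sI Id (qdim_add sJ1 sI IJ1 (@subsetT _ _) d1P eP).
move=> ->; case: e eP => [/(qdim0_sub sI)//|e _].
rewrite addnS ltnS; apply: leq_trans (leq_addr _ _).
apply: (IH (J 1%N) (fun i => J i.+1)) => //.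
by split=> // i il; [apply: Jid|apply: Jlt].
Qed.

(** Take f outside [I] in the last power of m not contained in [I]. Then m f lies in [I], so I + k f
    is already an ideal. *)
Lemma simple_ideal_extension I D : is_ideal I -> vanish D `<=` I -> I != setT ->
  exists J, [/\ is_ideal J, I `<=` J & qdim J I 1].
Proof.
move=> iI DI IT; have sI := ideal_subspace iI; have [I0 ID IM] := iI.
have [j nj jI] : exists2 j, ~ (vanish j `<=` I) & vanish j.+1 `<=` I.
  apply: contrapT => nex; suff: ~ (vanish D `<=` I) by [].
  elim: D {DI} => [TI|j IHj jI]; last by apply: nex; exists j.
  by case/eqP: IT; rewrite eqEsubset; split=> // f _; apply: TI.
have [f [fj nIf]] : exists f, vanish j f /\ ~ I f.
  by apply: contrapT => nf; apply: nj => f fj; apply: contrapT => ?; apply: nf; exists f.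
have fI g : I (g * f - g 0%MM *: f).
  have -> : g * f - g 0%MM *: f = (g - g 0%MM *: (1 : R)) * f.
    by rewrite mulrBl -seriesZAl mul1r.
  apply: jI; apply: (@vanishM _ _ 1) => //; rewrite -maxid_vanish /maxid /=.
  by rewrite seriesDE seriesNE seriesZE series1_0 mulr1 subrr.
pose J : set R := [set g | exists c, I (g - c *: f)].
exists J; split.
- split=> [|g g' [c Ic] [c' Ic']|g g' [c Ic]].
  + by exists 0; rewrite scale0r subr0.
  + by exists (c + c'); rewrite scalerDl opprD addrACA; apply: ID.
  + exists (c * g 0%MM); rewrite -scalerA.
    suff -> : g * g' - c *: (g 0%MM *: f) =
        g * (g' - c *: f) + c *: (g * f - g 0%MM *: f).
      by apply: ID; [apply: IM|case: sI => _ _; apply].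
    by rewrite mulrBr scalerBr addrA -seriesZAr subrK.
- by move=> g Ig; exists 0; rewrite scale0r subr0.
- apply: (@qdim1 _ _ _ _ f) => //.
  by exists 1; rewrite scale1r subrr.
Qed.

Lemma ideal_chain_qdim D d I : is_ideal I -> vanish D `<=` I ->
  qdim setT I d -> exists J, ideal_chain I d J.
Proof.
elim: d I => [|d IH] I iI DI Id; have sI := ideal_subspace iI.
  have IT : I = setT by rewrite eqEsubset; split=> // f _; exact: (qdim0_sub sI Id).
  by exists (fun _ => setT); split=> // i _; apply: setT_ideal.
have IT : I != setT.
  apply/eqP => IT; rewrite IT in Id sI.
  by have := qdim_uniq sI Id (qdim_self sI).
have [J [iJ IJ J1]] := simple_ideal_extension iI DI IT.
have DJ := subset_trans DI IJ; have sJ := ideal_subspace iJ.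
have [e eP] := qdim_quot iJ DJ.
have := qdim_uniq sI Id (qdim_add sJ sI IJ (@subsetT _ _) eP J1).
rewrite addn1 => -[de]; rewrite -de in eP.
have [K [K0 Kd Kid Klt]] := IH J iJ DJ eP.
exists (fun i => if i is i'.+1 then K i' else I); split=> //.
- by case=> [_ //|i]; rewrite ltnS; apply: Kid.
- case=> [_|i]; last by rewrite ltnS; apply: Klt.
  rewrite K0 properEneq; split=> //; apply/eqP => E; rewrite -E in J1.
  by have := qdim_uniq sI J1 (qdim_self sI).
Qed.

Lemma quot_lengthE D I d : is_ideal I -> vanish D `<=` I ->
  qdim setT I d -> quot_length I = d.
Proof.
move=> iI DI Id; have [J JP] := ideal_chain_qdim iI DI Id.
have le_d l : (exists J, ideal_chain I l J) -> (l <= d)%N.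
  by case=> J' JP'; apply: ideal_chain_le_qdim DI JP' Id.
apply: xget_unique => [|l [lP lmax]]; first by split; [exists J|].
by apply/eqP; rewrite eqn_leq le_d // lmax //; exists J.
Qed.

Lemma mcoeff_lincomb (T : finType) (a : T -> k) (F_ : T -> S) c :
  (\sum_t a t *: F_ t)@_c = \sum_t a t * (F_ t)@_c.
Proof. by rewrite raddf_sum; apply: eq_bigr => t _; rewrite /= mcoeffZ. Qed.

(** Dual bases for the constant-term pairing: [phi] gives the coordinates on R/I in the basis [f],
    and polynomials [G j] representing these coordinates form a basis of the inverse system. *)
Lemma qdim_perp D I d : is_ideal I -> vanish D `<=` I ->
  qdim setT I d -> qdim (perp I) [set 0] d.
Proof.
move=> iI DI [f [_ fsp fi]]; have sI := ideal_subspace iI.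
have [I0 ID IM] := iI; have [_ _ IZ] := sI.
have [phi phiP] := choice (fun g => fsp g Logic.I).
have phiE g a : I (g - \sum_j a j *: f j) -> phi g = a.
  move=> Ia; apply/funext => j; apply/eqP; rewrite -subr_eq0; apply/eqP.
  apply: (fi (fun j => phi g j - a j)).
  under eq_bigr do rewrite scalerBl.
  rewrite sumrB -(subrKA g) addrC; apply: ID => //.
  by rewrite -opprB; apply: subspaceN.
have phiI g : I g -> phi g = fun _ => 0.
  by move=> Ig; apply: phiE; rewrite big1 ?subr0 // => i _; rewrite scale0r.
have phif i : phi (f i) = fun j => (j == i)%:R.
  apply: phiE; rewrite (bigD1 i) //= eqxx scale1r big1 ?addr0 ?subrr // => j ji.
  by rewrite (negPf ji) scale0r.
have phiB g g' : I (g - g') -> phi g = phi g'.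
  by move=> gg'; apply: phiE; rewrite -(subrKA g'); apply: ID.
have phi_sum (T : finType) (a : T -> k) (g : T -> R) j :
    phi (\sum_t a t *: g t) j = \sum_t a t * phi (g t) j.
  rewrite (@phiE _ (fun j => \sum_t a t * phi (g t) j)) //.
  under [X in _ - X]eq_bigr do rewrite scaler_suml.
  rewrite exchange_big -sumrB; apply: (big_ind I) => // t _.
  under eq_bigr do rewrite -scalerA.
  by rewrite -scaler_sumr -scalerBr; apply: IZ.
(* Pairing with x^a reads the coefficient at [a], which dictates these coefficients. Stopping below
   degree [D] is harmless because [vanish D] lies in [I]. *)
pose G j : S := \sum_(a : 'X_{1..n < D}) phi (smonom k a) j *: 'X_[a].
have pairG g j : (contract g (G j))@_0 = phi g j.
  rewrite (@phiB g (\sum_(a : 'X_{1..n < D}) g a *: smonom k a)); last first.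
    apply: DI => m mD; rewrite seriesDE seriesNE; apply/eqP; rewrite subr_eq0.
    apply/eqP; rewrite -(big_bmnm_pred1 g mD).
    elim/big_rec2: _ => // a x y _ ->.
    by rewrite seriesDE seriesZE /smonom eq_sym.
  rewrite phi_sum contract_lincombr mcoeff_lincomb; apply: eq_bigr => a _.
  rewrite (@contractE _ _ D) ?msizeX ?bmdeg // mulrC; congr (_ * _).
  under eq_bigr do rewrite mcoeffX.
  rewrite (big_bmnm_shift 0 g (bmdeg a)) subm0.
  by case: ifP => // /negP[]; apply/mnm_lepP => i; rewrite mnm0E.
exists G; split=> [j g Ig|H HI|a aG i].
- apply/mpolyP => c; rewrite mcoeff_contract pairG mcoeff0 phiI //; exact: IM.
(* The coordinates of [H] are its pairings with the [f j]; equality is tested by pairing with every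
   monomial, reduced modulo [I]. *)
- exists (fun j => (contract (f j) H)@_0); apply/mpolyP => c.
  rewrite -[c]addm0 -contract_smonom; set g := smonom k c.
  rewrite (raddfB (contract g)) /= contract_lincombr mcoeffB mcoeff_lincomb mcoeff0.
  under eq_bigr do rewrite pairG.
  rewrite -[X in contract X H](subrK (\sum_j phi g j *: f j)) contractDl HI // add0r.
  rewrite contract_lincombl mcoeff_lincomb -sumrB big1 // => j _.
  by rewrite mulrC subrr.
- have := congr1 (fun H => (contract (f i) H)@_0) (aG : _ = 0).
  rewrite contract_lincombr mcoeff_lincomb raddf0 mcoeff0 => <-.
  under eq_bigr do rewrite pairG phif.
  rewrite (bigD1 i) //= eqxx mulr1 big1 ?addr0 // => j ji.
  by rewrite (negPf ji) mulr0.
Qed.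

Lemma qdim_setT_ann (F : S) : exists d, qdim setT (ann F) d.
Proof. exact: qdim_quot (ann_ideal F) (@vanish_sub_ann _ _ F). Qed.

Lemma quot_length_ann (F : S) d : qdim (cyclic_submod F) [set 0] d ->
  quot_length (ann F) = d.
Proof.
have [e eP] := qdim_setT_ann F.
move=> /(qdim_uniq (@subspace0 _ _) (qdim_cyclic eP)) <-.
exact: quot_lengthE (ann_ideal F) (@vanish_sub_ann _ _ F) eP.
Qed.

End Length.

(** * Covers of colength 0 and 1 *)

Section ColengthOne.
Variables (n : nat) (k : fieldType) (I : set (pseries n k)) (D d : nat).
Hypotheses (iI : is_ideal I) (DI : vanish D `<=` I) (Id : qdim setT I d).
Implicit Types (F G : {mpoly k[n]}).

Let sP : is_subspace (perp I) := @perp_subspace n k I.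
Let s0 : is_subspace [set 0 : {mpoly k[n]}] := @subspace0 _ _.
Let Pd : qdim (perp I) [set 0] d := qdim_perp iI DI Id.

Lemma set0_sub_subspace (U : set {mpoly k[n]}) : is_subspace U -> [set 0] `<=` U.
Proof. by move=> [U0 _ _] _ ->. Qed.

Lemma maxid_contract_subspace F : is_subspace (contract_set maxid F).
Proof. by rewrite maxid_vanish; exact/contract_set_subspace/vanish_ideal. Qed.

Lemma qdim_cyclicS F e : F != 0 -> qdim (contract_set maxid F) [set 0] e ->
  qdim (cyclic_submod F) [set 0] e.+1.
Proof.
move=> F0 Fe; have sM := maxid_contract_subspace F.
rewrite -add1n; apply: qdim_add (qdim_cyclic_maxid F0) Fe => //.
  exact: set0_sub_subspace.
by move=> _ [f _ <-]; exists f.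
Qed.

(* A cover of colength 0 would give [I = ann F]. *)
Lemma not_cover_length0 F : ~ gorenstein_quot I -> (0 < d)%N ->
  gorenstein_cover I F -> quot_length (ann F) <> d.
Proof.
move=> nG d_gt0 cover lF.
have [e Fe] := qdim_setT_ann F; have Ce := qdim_cyclic Fe.
rewrite (quot_length_ann Ce) in lF; rewrite {e}lF in Fe Ce.
(* <F> and [perp I] both have dimension [d], so the inclusion given by the cover is an equality. *)
have FP : perp I F.
  rewrite -(qdim_eq (cyclic_subspace F) sP s0 (set0_sub_subspace sP) cover Ce Pd).
  by exists 1; rewrite ?contract1.
have sA := ideal_subspace (ann_ideal F); have sI := ideal_subspace iI.
have IA : I `<=` ann F by move=> f If; apply: FP.
have [c AI] := qdim_sub sI sI (@subset_refl _ I) (@subsetT _ (ann F)) Id.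
have := qdim_add sA sI IA (@subsetT _ _) Fe AI => /(qdim_uniq sI Id)/eqP.
rewrite -[X in X == _]addn0 eqn_add2l => /eqP c0 _; rewrite -c0 in AI.
have EA : ann F = I by rewrite eqEsubset; split=> //; exact: (qdim0_sub sI AI).
apply: nG; rewrite -EA; apply: gorenstein_quot_ann; apply/eqP => F0.
have : qdim [set: pseries n k] (ann F) 0.
  rewrite (_ : ann F = setT); first exact: qdim_self.
  by rewrite eqEsubset; split=> // f _; rewrite /ann /= F0 raddf0.
by move/(qdim_uniq sA Fe) => dE; rewrite dE in d_gt0.
Qed.

Lemma cover_contract_maxid F :
    gorenstein_cover I F -> quot_length (ann F) = d.+1 ->
  contract_set maxid F = perp I.
Proof.
move=> cover lF; have [e Fe] := qdim_setT_ann F; have Ce := qdim_cyclic Fe.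
rewrite (quot_length_ann Ce) in lF; rewrite {e}lF in Fe Ce.
have sC := cyclic_subspace F; have sM := maxid_contract_subspace F.
have CF : cyclic_submod F F by exists 1; rewrite ?contract1.
have nPF : ~ perp I F.
  move=> PF; have CP : cyclic_submod F `<=` perp I.
    by move=> _ [f _ <-]; apply: perp_contract.
  have EC : cyclic_submod F = perp I by rewrite eqEsubset.
  by rewrite EC in Ce; have /esym/n_Sn := qdim_uniq s0 Ce Pd.
have [c CP _] := qdim_sub s0 sP (set0_sub_subspace sP) (@subset_refl _ _) Ce.
have /(qdim_uniq s0 Ce)/eqP := qdim_add sP s0 (set0_sub_subspace sP) cover CP Pd.
rewrite -add1n eqn_add2r => /eqP c1; rewrite -{c}c1 in CP.
have MP : contract_set maxid F `<=` perp I.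
  move=> _ [f mf <-].
  have [|c Pc] := @qdim1_span _ _ _ _ F (contract f F) sP CP CF nPF; first by exists f.
  (* Modulo [perp I], f o F is c F. If c were nonzero, the unit 1 - f/c would send [F] into
     [perp I], and then [F] itself would lie there. *)
  have [c0|c0] := eqVneq c 0; first by rewrite c0 scale0r subr0 in Pc.
  case: nPF; have mcf : maxid (c^-1 *: f).
    by rewrite /maxid /= seriesZE mf mulr0.
  have [u <-] := contract_1subr_inv F mcf; rewrite contractM; apply: perp_contract.
  case: (sP) => _ _ /(_ (- c^-1) _ Pc); rewrite contractBl contract1 contractZl.
  by rewrite scaleNr scalerBr scalerA mulVf // scale1r opprB.
have F0 : F != 0 by apply/eqP => F0; apply: nPF; rewrite F0; case: sP.
(* Since <F> has dimension d + 1 and m o F has codimension 1 in it, r = d and the inclusion [MP] is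
   an equality. *)
have [r rP _] := qdim_sub s0 s0 (@subset_refl _ _) MP Pd.
have [E] := qdim_uniq s0 Ce (qdim_cyclicS F0 rP); rewrite -E in rP.
exact/esym/(qdim_eq sP sM s0 (set0_sub_subspace sM) MP Pd rP).
Qed.

(* Nakayama: a change of [F] by an element [g o F] of [m o F] amounts to acting on
   [F] by the unit [1 - g]. *)
Lemma contract_maxid_sub_perp F G : contract_set maxid F = perp I -> perp I G ->
  contract_set maxid (F - G) = perp I.
Proof.
move=> E; rewrite -{1}E => -[g mg gF].
have EF : F - G = contract (1 - g) F by rewrite contractBl contract1 gF.
have [_ _ mM] : is_ideal (@maxid n k) by rewrite maxid_vanish; apply: vanish_ideal.
rewrite -E EF eqEsubset; split=> _ [f mf <-].
  by exists (f * (1 - g)); [rewrite mulrC; apply: mM|rewrite contractM].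
have [u uF] := contract_1subr_inv F mg.
by exists (u * f); [apply: mM|rewrite -[in RHS]uF [u * f]mulrC !contractM].
Qed.

(** The length of R/Ann F is one more than the dimension [d] of m o F, provided [F] is nonzero; d >
    0 ensures this, as F = 0 would make [perp I] zero. *)
Lemma contract_maxid_perp_cover F : (0 < d)%N ->
    contract_set maxid F = perp I ->
  gorenstein_cover I F /\ quot_length (ann F) = d.+1.
Proof.
move=> d_gt0 E; split; first by rewrite /gorenstein_cover -E => _ [f _ <-]; exists f.
apply/quot_length_ann/qdim_cyclicS; last by rewrite E.
apply/eqP => F0; have P0 : perp I = [set 0].
  rewrite -E F0 eqEsubset; split=> [_ [f _ <-]|]; first exact: (raddf0 (contract f)).
  exact: (set0_sub_subspace (maxid_contract_subspace 0)).
have := Pd; rewrite P0 => /(qdim_uniq s0 (qdim_self s0)) dE.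
by rewrite -dE in d_gt0.
Qed.

Lemma gcl_eq1P : ~ gorenstein_quot I -> (0 < d)%N ->
  gcl I = 1%N <-> exists F, contract_set maxid F = perp I.
Proof.
move=> nG d_gt0; have lI := quot_lengthE iI DI Id; rewrite /gcl lI.
split=> [|[F EF]].
  (* The default value of [gcl] is 0, so the value 1 comes from an actual cover. *)
  case: xgetP => // e _ [[F [cover lF]] _] e1; exists F.
  by apply: cover_contract_maxid => //; rewrite lF e1 addn1.
have [cover lF] := contract_maxid_perp_cover d_gt0 EF.
(* The cover [F] attains 1, and [not_cover_length0] excludes 0. *)
apply: xget_unique => [|e [[F' [cover' lF']] emin]].
  split=> [|[] // [F' [cover' lF']]]; first by exists F; rewrite lF addn1.
  by case: (not_cover_length0 nG d_gt0 cover'); rewrite lF' addn0.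
case: e lF' emin => [lF' _|e _ emin].
  by case: (not_cover_length0 nG d_gt0 cover'); rewrite lF' addn0.
have : (e.+1 <= 1)%N by apply: emin; exists F; rewrite lF addn1.
by case: e {emin}.
Qed.

(** Membership in the integral says that m o F lies in [perp I]; equal finite dimensions then force
    equality. *)
Lemma integral_maxid_perp_dimP F :
  integral maxid (perp I) F /\
    subspace_dim (contract_set maxid F) = subspace_dim (perp I) <->
  contract_set maxid F = perp I.
Proof.
have sM := maxid_contract_subspace F.
split=> [[mF]|E]; last by split=> [f mf|]; rewrite ?E // -E; exists f.
have MP : contract_set maxid F `<=` perp I by move=> _ [f mf <-]; apply: mF.
have [r rP _] := qdim_sub s0 s0 (@subset_refl _ _) MP Pd.
rewrite /subspace_dim (quot_dimE s0 rP) (quot_dimE s0 Pd) => E; rewrite E in rP.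
exact/esym/(qdim_eq sP sM s0 (set0_sub_subspace sM) MP Pd rP).
Qed.

End ColengthOne.

Theorem proposition3p11 (n : nat) (k : fieldType) (I : set (pseries n k))
    (s h : nat) (F_ : 'I_h -> {mpoly k[n]})
    (I_ideal : is_ideal I)
    (A_local : local_quot I)
    (A_artinian : artinian_quot I)
    (A_not_gorenstein : ~ gorenstein_quot I)
    (A_socle_degree : socle_degree I s)
    (s_ge1 : (1 <= s)%N)
    (F_basis : quot_basis (integral maxid (perp I)) (perp I) F_) :
  gcl I = 1%N <->
  exists a : 'I_h -> k,
    let F := \sum_(j < h) a j *: F_ j in
    integral maxid (perp I) F /\
    subspace_dim (contract_set maxid F) =
      subspace_dim (perp I).
Proof.
(* By maximality of [s], the power s + 1 of m lies in [I]. *)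
have DI : vanish s.+1 `<=` I.
  apply: subset_trans (@vanish_sub_ideal_exp n k s.+1) _.
  by apply: contrapT => /A_socle_degree.2; rewrite ltnn.
have [d Id] := qdim_quot I_ideal DI.
(* If d = 0 then I = R, which contains the power [s] of m, against the choice of [s]. *)
have d_gt0 : (0 < d)%N.
  case: d Id => // /(qdim0_sub (ideal_subspace I_ideal)) TI.
  by case: A_socle_degree.1; apply: subset_trans (@subsetT _ _) TI.
rewrite (gcl_eq1P I_ideal DI Id) //; split=> [[F EF]|[a]].
  have [mF _] := (integral_maxid_perp_dimP I_ideal DI Id F).2 EF.
  have [_ Fsp _] := F_basis; have [a Pa] := Fsp F mF; exists a.
  apply/(integral_maxid_perp_dimP I_ideal DI Id).
  (* The combination of the [F_ j] is [F] minus the remainder [Pa], which lies in [perp I]. *)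
  by rewrite -[X in contract_set _ X](subKr F); apply: contract_maxid_sub_perp.
by move=> /(integral_maxid_perp_dimP I_ideal DI Id) E; eexists; exact: E.
Qed.
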